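(* Let $\{\psi(\theta,S),\ \theta,S\in T_0\}$ be a biadmissible family which is uniformly right continuous and uniformly left continuous in expectation along stopping times. Suppose that there exists $p>1$ such that $$E\Big[\operatorname{ess\,sup}_{\theta,S\in T_0}\psi(\theta,S)^p\Big]<\infty.$$ Then for each $S\in T_0$ there exists a pair $(\tau_1^*,\tau_2^* )$ of stopping times in $T_S$ which is optimal for $v(S)=\operatorname{ess\,sup}_{\tau_1,\tau_2\in T_S}E[\psi(\tau_1,\tau_2)\mid\mathcal F_S]$, that is, $$v(S)=\operatorname{ess\,sup}_{\tau_1,\tau_2\in T_S}E[\psi(\tau_1,\tau_2)\mid\mathcal F_S]=E[\psi(\tau_1^*,\tau_2^* )\mid\mathcal F_S]\quad\text{a.s.}$$
   Context: Let $T\in[0,\infty)$ be a fixed constant and let $(\Omega,\mathcal F,(\mathcal F_t)_{0\le t\le T},P)$ be a filtered probability space with $\mathcal F=\mathcal F_T$, whose filtration satisfies the usual conditions (right continuity and augmentation by the null sets of $\mathcal F$), and such that $\mathcal F_0$ contains only sets of probability $0$ or $1$. $T_0$ denotes the set of stopping times with values in $[0,T]$. For $S\in T_0$, $T_S$ denotes the set of $\theta\in T_0$ with $S\le\theta$ a.s. A family $\{\psi(\theta,S),\theta,S\in T_0\}$ is biadmissible if (1) for all $\theta,S\in T_0$, $\psi(\theta,S)$ is a nonnegative $\mathcal F_{\theta\vee S}$-measurable random variable; (2) for all $\theta,\theta',S,S'\in T_0$, $\psi(\theta,S)=\psi(\theta',S')$ a.s. on $\{\theta=\theta'\}\cap\{S=S'\}$.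 Notation: $t_n\uparrow t$ means $\lim_n t_n=t$ with $t_n\le t$ for each $n$; $t_n\downarrow t$ means that $(t_n)$ is nonincreasing with $\lim_n t_n=t$. Let $\{\psi(\theta,S)\}$ be a biadmissible family with $E[\operatorname{ess\,sup}_{\theta,S\in T_0}\psi(\theta,S)]<\infty$. It is uniformly right (resp. left) continuous in expectation along stopping times if for every $S\in T_0$ and every sequence $(S_n)$ in $T_0$ with $S_n\downarrow S$ a.s. (resp. $S_n\uparrow S$ a.s.), $$\lim_{n\to\infty}E\Big(\operatorname{ess\,sup}_{\theta\in T_0}|\psi(\theta,S)-\psi(\theta,S_n)|\Big)=0\quad\text{and}\quad \lim_{n\to\infty}E\Big(\operatorname{ess\,sup}_{\theta\in T_0}|\psi(S,\theta)-\psi(S_n,\theta)|\Big)=0.$$ *)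

(* Defs.v *)
From HB Require Import structures.
From mathcomp Require Import all_boot all_order all_algebra.
From mathcomp Require Import all_classical all_reals all_analysis.
From mathcomp Require Import measurable_realfun.

Set Implicit Arguments.
Unset Strict Implicit.
Unset Printing Implicit Defensive.

Import Order.TTheory GRing.Theory Num.Theory.
Import numFieldNormedType.Exports.

Local Open Scope classical_set_scope.
Local Open Scope ring_scope.

(* The filtration is a total function F : R -> set (set Omega), but only its
   restriction to the time interval [0, T] is ever constrained or used.
   [filtration_null_sets] asks F 0 to contain the null events of the ambient
   sigma-algebra; the ambient probability space need not be complete. *)
Record usual_filtration d (Omega : measurableType d) (R : realType)
    (P : probability Omega R) (T : R) (F : R -> set (set Omega)) : Prop :=
  UsualFiltration {
    filtration_sigma_algebra : forall t, 0 <= t <= T ->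
      sigma_algebra [set: Omega] (F t) ;
    filtration_nondecreasing : forall s t, 0 <= s -> s <= t -> t <= T ->
      F s `<=` F t ;
    filtration_terminal : F T = measurable ;
    filtration_right_continuous : forall t, 0 <= t < T ->
      F t = \bigcap_(s in [set s | t < s <= T]) F s ;
    filtration_null_sets : forall N, measurable N -> P N = 0%E -> F 0 N ;
    filtration_trivial0 : forall A, F 0 A -> P A = 0%E \/ P A = 1%E }.

Section stopping_times.
Context d (Omega : measurableType d) (R : realType).
Variables (P : probability Omega R) (T : R) (F : R -> set (set Omega)).

Definition stopping_times : set (Omega -> R) :=
  [set tau | (forall w, 0 <= tau w <= T) /\
             (forall t, 0 <= t <= T -> F t [set w | tau w <= t])].

Definition stopping_times_from (S : Omega -> R) : set (Omega -> R) :=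
  [set tau | stopping_times tau /\ \forall w \ae P, S w <= tau w].

(* Taking t = T shows that such an A belongs to F T. *)
Definition stopped_sigma_algebra (tau : Omega -> R) : set (set Omega) :=
  [set A | forall t, 0 <= t <= T -> F t (A `&` [set w | tau w <= t])].

End stopping_times.

Section essential_supremum_and_conditional_expectation.
Context d (Omega : measurableType d) (R : realType).
Variable P : probability Omega R.

(* For a sigma-algebra G, the measurable sets of g_sigma_algebraType G are
   exactly the elements of G. *)
Definition measurable_wrt (G : set (set Omega)) (X : Omega -> R) : Prop :=
  measurable_fun [set: g_sigma_algebraType G] (X : g_sigma_algebraType G -> R).

(* Essential supremum of a possibly uncountable family of random variables:
   the a.s. smallest random variable that dominates a.s. each member. This is
   not the library's [ess_sup], which is the number attached to one function. *)
Definition is_family_ess_sup (A : set (Omega -> \bar R))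
    (V : Omega -> \bar R) : Prop :=
  [/\ measurable_fun [set: Omega] V,
      (forall X, A X -> \forall w \ae P, (X w <= V w)%E) &
      (forall W, measurable_fun [set: Omega] W ->
        (forall X, A X -> \forall w \ae P, (X w <= W w)%E) ->
        \forall w \ae P, (V w <= W w)%E)].

(* A version of the essential supremum: it exists for every family of
   extended-real random variables on a probability space and is a.s. unique,
   so that the default value of [xget] is never used for such a family. *)
Definition family_ess_sup (A : set (Omega -> \bar R)) : Omega -> \bar R :=
  xget (cst +oo%E) [set V | is_family_ess_sup A V].

Definition is_condexp (G : set (set Omega)) (X Y : Omega -> R) : Prop :=
  [/\ measurable_wrt G Y,
      P.-integrable [set: Omega] (EFin \o Y) &
      forall A, G A -> (\int[P]_(w in A) (Y w)%:E = \int[P]_(w in A) (X w)%:E)%E].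

(* A version of E[X | G]: it exists and is a.s. unique whenever G is a
   sub-sigma-algebra of the measurable sets and X is integrable. *)
Definition condexp (G : set (set Omega)) (X : Omega -> R) : Omega -> R :=
  xget (cst 0) [set Y | is_condexp G X Y].

End essential_supremum_and_conditional_expectation.

Section biadmissible_families.
Context d (Omega : measurableType d) (R : realType).
Variables (P : probability Omega R) (T : R) (F : R -> set (set Omega)).
Local Notation T0 := (stopping_times T F).

(* A family indexed by pairs of stopping times is a total function of two maps
   Omega -> R; only its values on pairs of stopping times matter. *)
Implicit Type psi : (Omega -> R) -> (Omega -> R) -> Omega -> R.

Definition biadmissible psi : Prop :=
  (forall theta S, T0 theta -> T0 S ->
    (forall w, 0 <= psi theta S w) /\
    measurable_wrt
      (stopped_sigma_algebra T F (fun w => Num.max (theta w) (S w)))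
      (psi theta S)) /\
  (forall theta theta' S S', T0 theta -> T0 theta' -> T0 S -> T0 S' ->
    \forall w \ae P, theta w = theta' w -> S w = S' w ->
      psi theta S w = psi theta' S' w).

Definition as_nonincreasing_to (S_ : nat -> Omega -> R) (S : Omega -> R) :=
  \forall w \ae P, nonincreasing_seq (fun n => S_ n w) /\
                   (S_ n w @[n --> \oo] --> S w).

(* No monotonicity in n here: the sequence only stays below its limit. *)
Definition as_from_below_to (S_ : nat -> Omega -> R) (S : Omega -> R) :=
  \forall w \ae P, (forall n, S_ n w <= S w) /\
                   (S_ n w @[n --> \oo] --> S w).

Definition uniformly_close_in_expectation psi
    (S_ : nat -> Omega -> R) (S : Omega -> R) : Prop :=
  ((\int[P]_w family_ess_sup P
      [set (fun w' => `|psi theta S w' - psi theta (S_ n) w'|%:E)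
        | theta in T0] w)%E @[n --> \oo] --> 0%E) /\
  ((\int[P]_w family_ess_sup P
      [set (fun w' => `|psi S theta w' - psi (S_ n) theta w'|%:E)
        | theta in T0] w)%E @[n --> \oo] --> 0%E).

Definition uniformly_right_continuous_in_expectation psi : Prop :=
  forall S (S_ : nat -> Omega -> R), T0 S -> (forall n, T0 (S_ n)) ->
    as_nonincreasing_to S_ S -> uniformly_close_in_expectation psi S_ S.

Definition uniformly_left_continuous_in_expectation psi : Prop :=
  forall S (S_ : nat -> Omega -> R), T0 S -> (forall n, T0 (S_ n)) ->
    as_from_below_to S_ S -> uniformly_close_in_expectation psi S_ S.

Definition value psi (S : Omega -> R) : Omega -> \bar R :=
  family_ess_sup P
    [set (EFin \o condexp P (stopped_sigma_algebra T F S) (psi tau1 tau2))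
      | tau1 in stopping_times_from P T F S
      & tau2 in stopping_times_from P T F S].

End biadmissible_families.

(* Main.v *)
Require Import Defs.
From HB Require Import structures.
From mathcomp Require Import all_boot all_order all_algebra.
From mathcomp Require Import all_classical all_reals all_analysis.
From mathcomp Require Import measurable_realfun.
From mathcomp Require Import lra.

Set Implicit Arguments.
Unset Strict Implicit.
Unset Printing Implicit Defensive.

Import Order.TTheory GRing.Theory Num.Theory.
Import numFieldNormedType.Exports.

Local Open Scope classical_set_scope.
Local Open Scope ring_scope.

(** The expected reward of a pair of stopping times is maximized directly,
without a Snell envelope. A bounded function [f] on a lattice of stopping times
that satisfies
[[
  f a + f b <= f (a `&` b) + f (a `|` b)
]]
and is upper semicontinuous along monotone sequences attains its supremum: if
[u_k] is a maximizer up to [2^-k], then the meet of [u_j, ..., u_n] is one up to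
[2 * 2^-j], so that right continuity applies to the infimum over [n] and left
continuity to the supremum over [j]; the limit inferior of the [u_k] is optimal
([supermodular_attains]).

The expected reward of a pair need not be supermodular in both coordinates at
once, but two functions derived from it are. With one coordinate fixed, it is
modular in the other, by locality of the family ([tame_modular]). And the best
expected reward [W theta] of the pairs whose first stopping takes place at
[theta] is supermodular, because two pairs can be recombined along the event on
which one starts before the other ([first_time_value_supermodular]).

Upper semicontinuity of [W] along [u_n] tending to [theta] ([pair_usc]) combines
three facts. By uniform continuity of the reward the coordinate that stops first
can be moved from [u_n] to [theta]. Then a single second time, obtained from the
one-coordinate problem, is nearly optimal for all [n], even on events
([near_second_time_event]). What remains is to choose the event that decides
which coordinate stops first; it is known at [u_n], and an optimal one known at
[theta] exists by the same maximization principle applied to events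
([best_event]) and by right continuity of the filtration
([stopped_nonincreasing_limit]).

A maximizer of [W] after [S] thus gives a pair that maximizes the expected
reward ([optimal_pair]). Pasting on the events of the sigma-algebra of [S] shows
that it also maximizes the conditional expectation given this sigma-algebra, so
that this conditional expectation is the essential supremum. *)

(** * Maximizing a supermodular function *)

Definition usc_along (X : Type) (R : realType) (f : X -> R)
    (u : nat -> X) (l : X) : Prop :=
  forall c, (\forall n \near \oo, c <= f (u n)) -> c <= f l.

(** The limit inferior of a sequence of near maximizers is a maximizer. The
    domain may shrink with the index; the maximizer then belongs to all the
    domains and reaches the limit of the suprema. The lattices to which this is
    applied consist of stopping times and of events. *)
Lemma supermodular_attains (disp : Order.disp_t) (X : latticeType disp)
    (R : realType) (f : X -> R) (L : nat -> set X) :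
  (forall m n, (m <= n)%N -> L n `<=` L m) ->
  (forall k, L k !=set0) ->
  (exists M, forall a, L 0%N a -> f a <= M) ->
  (forall k a b, L k a -> L k b -> L k (a `&` b)%O /\ L k (a `|` b)%O) ->
  (forall a b, L 0%N a -> L 0%N b ->
    f a + f b <= f (a `&` b)%O + f (a `|` b)%O) ->
  (forall k (u : nat -> X), {homo u : m n / (m <= n)%N >-> (n <= m)%O} ->
    (forall n, L k (u n)) ->
    exists l, [/\ L k l, (forall n, (l <= u n)%O),
      (forall m, (forall n, (m <= u n)%O) -> (m <= l)%O) & usc_along f u l]) ->
  (forall u : nat -> X, {homo u : m n / (m <= n)%N >-> (m <= n)%O} ->
    (forall n, L n (u n)) -> exists l, (forall k, L k l) /\ usc_along f u l) ->
  exists a, (forall k, L k a) /\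
    forall c, (forall k, exists2 b, L k b & c <= f b) -> c <= f a.
Proof.
move=> Ldec Lne [M fM] Llat fsup Hdec Hinc.
have L0 k : L k `<=` L 0%N by apply: Ldec.
have /choice[u uP] : forall k, exists v, L k v /\
    forall b, L k b -> f b <= f v + 2^-1 ^+ k.
  move=> k; pose E := f @` L k.
  have E0 : E !=set0 by have [x Lx] := Lne k; exists (f x), x.
  have hE : has_sup E.
    by split=> //; exists M => _ [x Lx <-]; exact/fM/(L0 k).
  have e0 : 0 < 2^-1 ^+ k :> R by rewrite exprn_gt0// invr_gt0.
  have [_ [v Lv <-] hv] := sup_adherent e0 hE.
  exists v; split=> // b Lb.
  have : f b <= sup E by apply: ub_le_sup; [case: hE|exists b].
  by move=> /le_trans -> //; rewrite -lerBlDr ltW.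
(* [m n j] is the meet of u_j, ..., u_(j+n), folded from the right: this is
   the order in which the supermodular inequality loses only the sum of the
   individual defects. *)
pose m := fix m n j := if n is n'.+1 then (u j `&` m n' j.+1)%O else u j.
have mL n j : L j (m n j).
  elim: n j => [|n IH] j /=; first by have [] := uP j.
  have [Lu _] := uP j.
  by have [] := Llat j (u j) (m n j.+1) Lu (Ldec _ _ (leqnSn j) _ (IH j.+1)).
have m_dec j : {homo m^~ j : p q / (p <= q)%N >-> (q <= p)%O}.
  apply: homo_leq => [x|y x z xy yz|n]; first exact: lexx.
    exact: le_trans yz xy.
  elim: n j => [|n IH] j; first exact: leIl.
  rewrite [X in (X <= _)%O]/= [X in (_ <= X)%O]/=.
  by apply: leI2; [exact: lexx|exact: IH].
have mf c : (forall k, exists2 b, L k b & c <= f b) ->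
    forall n j, c - 2 * 2^-1 ^+ j <= f (m n j).
  move=> cP; elim=> [|n IH] j.
    have [b Lb cb] := cP j; have [_ /(_ _ Lb)] := uP j.
    have e0 : 0 < 2^-1 ^+ j :> R by rewrite exprn_gt0// invr_gt0.
    rewrite /=; lra.
  have := IH j.+1; rewrite exprS.
  have [Lu uj] := uP j.
  have Lm := Ldec _ _ (leqnSn j) _ (mL n j.+1).
  have [_ /uj] := Llat j _ _ Lu Lm.
  have := fsup _ _ (L0 _ _ Lu) (L0 _ _ Lm).
  rewrite /=; lra.
have /choice[d dP] : forall j, exists l, [/\ L j l, (forall n, (l <= m n j)%O),
    (forall x, (forall n, (x <= m n j)%O) -> (x <= l)%O) &
    usc_along f (m^~ j) l].
  by move=> j; apply: Hdec => //; exact: m_dec.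
have [||l [Ll lusc]] := Hinc d.
- apply: homo_leq => [x|y x z|j]; [exact: lexx|exact: le_trans|].
  have [_ dj _ _] := dP j; have [_ _ glb _] := dP j.+1.
  by apply: glb => n; apply: le_trans (dj n.+1) _; exact: leIr.
- by move=> n; have [] := dP n.
exists l; split=> // c cP.
have fd j : c - 2 * 2^-1 ^+ j <= f (d j).
  by have [_ _ _] := dP j; apply; apply: nearW => n; exact: mf.
apply/ler_addgt0Pr => e e0; rewrite -lerBlDr; apply: lusc.
have : (2 * 2^-1 ^+ j : R) @[j --> \oo] --> (2 * 0 : R).
  apply: cvgM; first exact: cvg_cst.
  by apply: cvg_expr; rewrite ger0_norm ?invr_ge0// invf_lt1 ?ltr1n.
rewrite mulr0 => /cvgrPdist_lt/(_ _ e0); apply: filterS => j.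
rewrite sub0r normrN ger0_norm ?mulr_ge0 ?exprn_ge0 ?invr_ge0// => je.
by apply: le_trans (fd j); rewrite lerB// ltW.
Qed.

(** * Stopping times *)

Section sigma_algebra_closure.
Context (U : Type) (G : set (set U)).
Hypothesis sG : sigma_algebra [set: U] G.

Lemma sigma_algebra_setT : G [set: U].
Proof. by case: sG => G0 GC _; rewrite -(setD0 setT); exact: GC. Qed.

Lemma sigma_algebra_setC (A : set U) : G A -> G (~` A).
Proof. by case: sG => _ GC _ GA; rewrite -setTD; exact: GC. Qed.

Lemma sigma_algebra_bigcup_nat (A : nat -> set U) :
  (forall n, G (A n)) -> G (\bigcup_n A n).
Proof. by case: sG => _ _; exact. Qed.

Lemma sigma_algebra_bigcap_nat (A : nat -> set U) :
  (forall n, G (A n)) -> G (\bigcap_n A n).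
Proof.
move=> GA; rewrite -(setCK (\bigcap_n _)) setC_bigcap.
apply/sigma_algebra_setC/sigma_algebra_bigcup_nat => n.
exact: sigma_algebra_setC.
Qed.

Lemma sigma_algebra_setU (A B : set U) : G A -> G B -> G (A `|` B).
Proof.
move=> GA GB; rewrite -bigcup2E; apply: sigma_algebra_bigcup_nat => -[|[|n]]//=.
by case: sG.
Qed.

Lemma sigma_algebra_setI (A B : set U) : G A -> G B -> G (A `&` B).
Proof.
move=> GA GB; rewrite -(setCK (A `&` B)) setCI.
by apply/sigma_algebra_setC/sigma_algebra_setU; exact: sigma_algebra_setC.
Qed.

Lemma sigma_algebra_setD (A B : set U) : G A -> G B -> G (A `\` B).
Proof.
by move=> GA GB; rewrite setDE; apply/sigma_algebra_setI/sigma_algebra_setC.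
Qed.

End sigma_algebra_closure.

Definition monotone_to (U : Type) (R : realType) (u : nat -> U -> R)
    (l : U -> R) : Prop :=
  ({homo u : m n / (m <= n)%N >-> (n <= m)%O} \/
   {homo u : m n / (m <= n)%N >-> (m <= n)%O}) /\
  (forall w, u n w @[n --> \oo] --> l w).

Section monotone_limits.
Context (U : Type) (R : realType).
Implicit Types (u : nat -> U -> R) (l : U -> R).

Lemma nonincreasing_limit_le u l :
  {homo u : m n / (m <= n)%N >-> (n <= m)%O} ->
  (forall w, u n w @[n --> \oo] --> l w) -> forall n, (l <= u n)%O.
Proof.
move=> udec ul n; apply/lefP => w.
have ndec : nonincreasing_seq (u^~ w).
  by move=> p q pq; have /lefP := udec _ _ pq; exact.
rewrite -(cvg_lim _ (ul w))//; apply: nonincreasing_cvgn_ge => //.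
by apply/cvg_ex; exists (l w); exact: ul.
Qed.

Lemma nondecreasing_limit_ge u l :
  {homo u : m n / (m <= n)%N >-> (m <= n)%O} ->
  (forall w, u n w @[n --> \oo] --> l w) -> forall n, (u n <= l)%O.
Proof.
move=> uinc ul n; apply/lefP => w.
have ninc : nondecreasing_seq (u^~ w).
  by move=> p q pq; have /lefP := uinc _ _ pq; exact.
rewrite -(cvg_lim _ (ul w))//; apply: nondecreasing_cvgn_le => //.
by apply/cvg_ex; exists (l w); exact: ul.
Qed.

Lemma nonincreasing_pointwise_cvg u (c : R) :
  {homo u : m n / (m <= n)%N >-> (n <= m)%O} -> (forall n w, c <= u n w) ->
  exists l, forall w, u n w @[n --> \oo] --> l w.
Proof.
move=> udec cu; exists (fun w => inf (range (u^~ w))) => w.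
apply: nonincreasing_cvgn; last by exists c => _ [n _ <-].
by move=> p q pq; have /lefP := udec _ _ pq; exact.
Qed.

Lemma nondecreasing_pointwise_cvg u (c : R) :
  {homo u : m n / (m <= n)%N >-> (m <= n)%O} -> (forall n w, u n w <= c) ->
  exists l, forall w, u n w @[n --> \oo] --> l w.
Proof.
move=> uinc uc; exists (fun w => sup (range (u^~ w))) => w.
apply: nondecreasing_cvgn; last by exists c => _ [n _ <-].
by move=> p q pq; have /lefP := uinc _ _ pq; exact.
Qed.

Lemma limit_ge (u : nat -> R) (l c : R) :
  u n @[n --> \oo] --> l -> (forall n, c <= u n) -> c <= l.
Proof.
move=> ul cu; rewrite -(cvg_lim _ ul)//; apply: limr_ge; last exact: nearW.
by apply/cvg_ex; exists l.
Qed.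

Lemma limit_le (u : nat -> R) (l c : R) :
  u n @[n --> \oo] --> l -> (forall n, u n <= c) -> l <= c.
Proof.
move=> ul uc; rewrite -(cvg_lim _ ul)//; apply: limr_le; last exact: nearW.
by apply/cvg_ex; exists l.
Qed.

End monotone_limits.

Section stopping_time_theory.
Context d (Omega : measurableType d) (R : realType).
Context (P : probability Omega R) (T : R) (F : R -> set (set Omega)).
Hypotheses (T_ge0 : 0 <= T) (HF : usual_filtration P T F).
Local Notation T0 := (stopping_times T F).
Local Notation stopped := (stopped_sigma_algebra T F).
Implicit Types (a b tau theta S : Omega -> R) (A B : set Omega).

Let sF t : 0 <= t <= T -> sigma_algebra setT (F t).
Proof. exact: filtration_sigma_algebra HF t. Qed.

Let Fle s t A : 0 <= s -> s <= t -> t <= T -> F s A -> F t A.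
Proof. by move=> s0 st tT; exact: (filtration_nondecreasing HF). Qed.

Let TT : 0 <= T <= T. Proof. by rewrite T_ge0 lexx. Qed.

Lemma stopped_measurable tau B :
  (forall w, 0 <= tau w <= T) -> stopped tau B -> measurable B.
Proof.
move=> tauT /(_ T TT); rewrite (filtration_terminal HF).
rewrite (_ : [set w | _] = setT) ?setIT// -subTset => w _ /=.
by case/andP: (tauT w).
Qed.

Lemma stopping_timeE tau :
  T0 tau <-> (forall w, 0 <= tau w <= T) /\ stopped tau setT.
Proof.
by split=> -[tauT h]; split=> // t tT; have := h t tT; rewrite setTI.
Qed.

Lemma stopped_sigma_algebraP tau : T0 tau -> sigma_algebra setT (stopped tau).
Proof.
move=> [tauT tauF]; split.
- by move=> t tT; rewrite set0I; case: (sF tT).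
- move=> A FA t tT.
  rewrite (_ : _ `&` _ = [set w | tau w <= t] `\` (A `&` [set w | tau w <= t])).
    by apply: (sigma_algebra_setD (sF tT)); [exact: tauF|exact: FA].
  apply/seteqP; split=> w /=; last first.
    by move=> [h k]; split=> //; split=> // Aw; apply: k.
  by move=> [[_ nA] h]; split=> // -[].
- move=> A FA t tT; rewrite setI_bigcupl.
  by apply: (sigma_algebra_bigcup_nat (sF tT)) => n; exact: FA.
Qed.

Lemma stopped_le a b B : (a <= b)%O -> T0 b -> stopped a B -> stopped b B.
Proof.
move=> /lefP ab [_ bF] aB t tT.
rewrite (_ : _ `&` _ = (B `&` [set w | a w <= t]) `&` [set w | b w <= t]).
  by apply: (sigma_algebra_setI (sF tT)); [exact: aB|exact: bF].
apply/seteqP; split=> w /=; last by move=> [[]].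
by move=> [Bw bw]; do !split=> //; exact: le_trans (ab w) bw.
Qed.

(** This is where right continuity of the filtration enters: it makes the
    information available at a decreasing sequence of times shrink to the
    information available at the limit. For [B = setT] the lemma says that the
    limit is again a stopping time. *)
Lemma stopped_nonincreasing_limit (u : nat -> Omega -> R) tau B :
  {homo u : m n / (m <= n)%N >-> (n <= m)%O} ->
  (forall w, u n w @[n --> \oo] --> tau w) ->
  (forall n w, 0 <= u n w <= T) ->
  (forall n, stopped (u n) B) -> stopped tau B.
Proof.
move=> udec ucv uT uB t /andP[t0 tT].
have tauu n w : tau w <= u n w.
  by have /lefP := nonincreasing_limit_le udec ucv n; exact.
have [tltT|] := ltP t T; last first.
  move=> Tt; have -> : t = T by apply/eqP; rewrite eq_le tT.
  have := uB 0%N T TT; congr (F T (_ `&` _)); apply/seteqP; split=> w /= _.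
    by apply: le_trans (tauu 0%N w) _; case/andP: (uT 0%N w).
  by case/andP: (uT 0%N w).
rewrite (filtration_right_continuous HF) ?t0// => s /= /andP[ts sT].
have s0 : 0 <= s by exact: le_trans t0 (ltW ts).
have sFs : sigma_algebra setT (F s) by apply: sF; rewrite s0.
pose e m := (s - t) / m.+1%:R : R.
have e0 m : 0 < e m by rewrite divr_gt0 ?subr_gt0.
have es m : t + e m <= s.
  rewrite -lerBrDl ler_pdivrMr// ler_peMr ?subr_ge0 ?(ltW ts)//.
  by rewrite ler1n.
(* [tau <= t] holds when every [t + e m] is eventually above the sequence, and
   the corresponding event is known at time [t + e m <= s]. *)
rewrite (_ : _ `&` _ =
    \bigcap_m \bigcup_n (B `&` [set w | u n w <= t + e m])).
  apply: (sigma_algebra_bigcap_nat sFs) => m.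
  apply: (sigma_algebra_bigcup_nat sFs) => n.
  apply: (@Fle (t + e m)) => //; first by rewrite addr_ge0// ltW.
  by apply: uB; rewrite addr_ge0 ?(ltW (e0 m))//=; exact: le_trans (es m) sT.
apply/seteqP; split=> w /=.
  move=> [Bw tw] m _.
  have /cvgrPdist_lt/(_ _ (e0 m))[N _ /(_ N (leqnn N))] := ucv w.
  rewrite /= distrC => /ltr_normlW h; exists N => //; split=> //=.
  by rewrite -lerBlDl; apply: le_trans (ltW h); rewrite lerB.
move=> h; split; first by have [n _ []] := h 0%N I.
apply/ler_addgt0Pr => r r0.
have [m hm] : exists m, e m <= r.
  have [m hm] : exists m : nat, (s - t) / r < m.+1%:R.
    exists (Num.truncn ((s - t) / r)); apply: truncnS_gt.
  exists m; rewrite ler_pdivrMr// mulrC -ler_pdivrMr//.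
  exact: ltW.
have [n _ [_ /= un]] := h m I.
by apply: le_trans (tauu n w) _; apply: le_trans un _; rewrite lerD2l.
Qed.

Lemma stopping_time_nonincreasing_limit (u : nat -> Omega -> R) tau :
  {homo u : m n / (m <= n)%N >-> (n <= m)%O} ->
  (forall w, u n w @[n --> \oo] --> tau w) -> (forall n, T0 (u n)) -> T0 tau.
Proof.
move=> udec ucv uT; apply/stopping_timeE; split=> [w|]; last first.
  apply: (stopped_nonincreasing_limit udec ucv) => n; first by case: (uT n).
  by have /stopping_timeE[] := uT n.
apply/andP; split; first
    by apply: limit_ge (ucv w) _ => n; case: (uT n) => /(_ w)/andP[].
by apply: limit_le (ucv w) _ => n; case: (uT n) => /(_ w)/andP[].
Qed.

Lemma stopping_time_nondecreasing_limit (u : nat -> Omega -> R) tau :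
  {homo u : m n / (m <= n)%N >-> (m <= n)%O} ->
  (forall w, u n w @[n --> \oo] --> tau w) -> (forall n, T0 (u n)) -> T0 tau.
Proof.
move=> uinc ucv uT; split=> [w|t tT].
  apply/andP; split; first
    by apply: limit_ge (ucv w) _ => n; case: (uT n) => /(_ w)/andP[].
  by apply: limit_le (ucv w) _ => n; case: (uT n) => /(_ w)/andP[].
rewrite (_ : [set w | _] = \bigcap_n [set w | u n w <= t]).
  by apply: (sigma_algebra_bigcap_nat (sF tT)) => n; case: (uT n) => _; exact.
apply/seteqP; split=> w /=; last first.
  by move=> h; apply: limit_le (ucv w) _ => n; exact: h.
move=> tw n _; apply: le_trans tw.
by have /lefP := nondecreasing_limit_ge uinc ucv n; exact.
Qed.

Lemma stopping_time_meet a b : T0 a -> T0 b -> T0 (a `&` b)%O.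
Proof.
move=> [aT aF] [bT bF]; split=> [w|t tT].
  have := aT w; have := bT w; rewrite meetfE meetEtotal.
  by case: (leP (a w) (b w)).
rewrite (_ : [set w | _] = [set w | a w <= t] `|` [set w | b w <= t]).
  by apply: (sigma_algebra_setU (sF tT)); [exact: aF|exact: bF].
apply/seteqP; split=> w; rewrite /= meetfE meetEtotal ge_min.
  by move/orP.
by move/orP.
Qed.

Lemma stopping_time_join a b : T0 a -> T0 b -> T0 (a `|` b)%O.
Proof.
move=> [aT aF] [bT bF]; split=> [w|t tT].
  have := aT w; have := bT w; rewrite joinfE joinEtotal.
  by case: (leP (a w) (b w)).
rewrite (_ : [set w | _] = [set w | a w <= t] `&` [set w | b w <= t]).
  by apply: (sigma_algebra_setI (sF tT)); [exact: aF|exact: bF].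
apply/seteqP; split=> w; rewrite /= joinfE joinEtotal ge_max.
  by move/andP.
by move=> ?; apply/andP.
Qed.

Lemma stopping_time_patch theta B a b :
  T0 theta -> stopped theta B -> T0 a -> T0 b ->
  (theta <= a)%O -> (theta <= b)%O -> T0 (patch b B a).
Proof.
move=> thT BF [aT aF] [bT bF] /lefP tha /lefP thb; split=> [w|t tT].
  by rewrite /patch; case: ifP.
have BFC : stopped theta (~` B).
  exact: (sigma_algebra_setC (stopped_sigma_algebraP thT)).
rewrite (_ : [set w | _] =
    ((B `&` [set w | theta w <= t]) `&` [set w | a w <= t]) `|`
    ((~` B `&` [set w | theta w <= t]) `&` [set w | b w <= t])).
  by apply: (sigma_algebra_setU (sF tT)); apply: (sigma_algebra_setI (sF tT));
    [exact: BF|exact: aF|exact: BFC|exact: bF].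
apply/seteqP; split=> w /=; rewrite /patch; case: ifPn => [/set_mem|] wB.
- by move=> h; left; do !split=> //; exact: le_trans (tha w) h.
- move=> h; right; do !split=> //; last exact: le_trans (thb w) h.
  by move=> /mem_set; exact/negP.
- by move=> [[[]]|[[]]].
- by move=> [[[/mem_set]]|[[]]]//; rewrite (negbTE wB).
Qed.

Lemma stopped_le_event_l a b : T0 a -> T0 b -> stopped a [set w | a w <= b w].
Proof.
move=> [aT aF] [bT bF] t tT; have [t0 tT'] := andP tT.
(* [b < a <= t] holds when a rational [q] in [0, t] separates [b] from [a]. *)
pose D n := if unpickle n is Some q then
  if 0 <= (ratr q : R) <= t then
    [set w | b w <= (ratr q : R)] `\` [set w | a w <= (ratr q : R)]
  else set0 else set0.
rewrite (_ : _ `&` _ = [set w | a w <= t] `\` \bigcup_n D n).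
  apply: (sigma_algebra_setD (sF tT)); first exact: aF.
  apply: (sigma_algebra_bigcup_nat (sF tT)) => n; rewrite /D.
  have F0 : F t set0 by case: (sF tT).
  case: unpickle => // q; case: ifP => // /andP[q0 qt].
  apply: (Fle q0 qt tT').
  have qT : 0 <= (ratr q : R) <= T by rewrite q0 (le_trans qt).
  by apply: (sigma_algebra_setD (sF qT)); [exact: bF|exact: aF].
apply/seteqP; split=> w /=.
  move=> [ab aw]; split=> // -[n _]; rewrite /D; case: unpickle => // q.
  case: ifP => // _ [/= bq]; apply; exact: le_trans ab bq.
move=> [aw nD]; split=> //; rewrite leNgt; apply/negP => ba; apply: nD.
have [q /[!in_itv]/= /andP[bq qa]] := rat_in_itvoo ba.
exists (pickle q); first exact: I.
rewrite /D pickleK ifT; last first.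
  rewrite (le_trans _ (ltW bq)) ?(le_trans (ltW qa) aw)//.
  by case/andP: (bT w).
split=> /=; first exact: ltW.
by apply/negP; rewrite -ltNge.
Qed.

Lemma stopped_le_event_meet a b :
  T0 a -> T0 b -> stopped (a `&` b)%O [set w | a w <= b w].
Proof.
move=> aT bT t tT; have := stopped_le_event_l aT bT tT.
congr (F t _); apply/seteqP; split=> w /=; rewrite meetfE meetEtotal => -[ab];
  by move: (ab) => /min_idPl ->.
Qed.

End stopping_time_theory.

(** * Optimal events *)

Section integral_over_events.
Context d (Omega : measurableType d) (R : realType) (P : probability Omega R).
Implicit Types (X Y : Omega -> R) (A B : set Omega).

Lemma integrable_event Y A : measurable A ->
  P.-integrable setT (EFin \o Y) -> P.-integrable A (EFin \o Y).
Proof. by move=> mA iY; exact: integrableS iY. Qed.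

Lemma Rintegral_disjointU Y A B : measurable A -> measurable B ->
  A `&` B = set0 -> P.-integrable setT (EFin \o Y) ->
  \int[P]_(w in A `|` B) Y w = \int[P]_(w in A) Y w + \int[P]_(w in B) Y w.
Proof.
move=> mA mB AB0 iY; apply: Rintegral_setU => //.
  by apply: integrable_event => //; exact: measurableU.
exact/disj_set2P.
Qed.

Lemma Rintegral_setC Y B : measurable B -> P.-integrable setT (EFin \o Y) ->
  \int[P]_w Y w = \int[P]_(w in B) Y w + \int[P]_(w in ~` B) Y w.
Proof.
move=> mB iY; rewrite -Rintegral_disjointU ?setUv ?setICr//.
exact: measurableC.
Qed.

Lemma Rintegral_modular Y A B : measurable A -> measurable B ->
  P.-integrable setT (EFin \o Y) ->
  \int[P]_(w in A) Y w + \int[P]_(w in B) Y w =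
  \int[P]_(w in A `&` B) Y w + \int[P]_(w in A `|` B) Y w.
Proof.
move=> mA mB iY; have mBA : measurable (B `\` A) by exact: measurableD.
have -> : A `|` B = A `|` (B `\` A) by rewrite setDE setUIr setUCr setIT.
rewrite {1}(_ : B = (A `&` B) `|` (B `\` A)); last by rewrite setIC setUIDK.
rewrite !Rintegral_disjointU//; [lra|..|exact: measurableI|].
- by apply/seteqP; split=> w //= [Aw [_]].
- by apply/seteqP; split=> w //= [[Aw _] [_]].
Qed.

Lemma ae_eq_Rintegral X Y B : measurable B ->
  P.-integrable setT (EFin \o X) -> P.-integrable setT (EFin \o Y) ->
  (\forall w \ae P, B w -> X w = Y w) ->
  \int[P]_(w in B) X w = \int[P]_(w in B) Y w.
Proof.
move=> mB iX iY XY; congr fine; apply: ae_eq_integral => //.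
- exact: measurable_int (integrable_event mB iX).
- exact: measurable_int (integrable_event mB iY).
- by apply: filterS XY => w h Bw /=; rewrite h.
Qed.

Lemma Rintegral_event_cvg Y (A : nat -> set Omega) B :
  P.-integrable setT (EFin \o Y) ->
  (forall n, measurable (A n)) -> measurable B ->
  (forall w, \forall n \near \oo, A n w <-> B w) ->
  \int[P]_(w in A n) Y w @[n --> \oo] --> \int[P]_(w in B) Y w.
Proof.
move=> iY mA mB AB.
under eq_fun do rewrite Rintegral_mkcond.
rewrite Rintegral_mkcond /Rintegral.
have mY := measurable_int _ iY.
have mr C : measurable C -> measurable_fun setT (EFin \o (Y \_ C)).
  move=> mC; rewrite -restrict_EFin; apply/(measurable_restrictT _ mC).
  exact: measurable_funTS.
have [] := @dominated_convergence _ _ _ P setT measurableT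
  (fun n => EFin \o (Y \_ (A n))) (EFin \o (Y \_ B)) (abse \o (EFin \o Y)).
- by move=> n; exact: mr.
- exact: mr.
- apply: aeW => w _; apply: cvg_near_cst; apply: filterS (AB w) => n h /=.
  rewrite !patchE; congr (EFin (if _ then _ else _)).
  by apply/idP/idP => /set_mem/h/mem_set.
- exact: integrable_abse.
- apply: aeW => w n _ /=; rewrite patchE; case: ifP => _ //.
  by rewrite lee_fin normr0.
- move=> iYB _; rewrite -(fineK (integrable_fin_num measurableT iYB)).
  by move=> /fine_cvg.
Qed.

(** The maximizer of the integral of [Y] over a decreasing sequence of
    sigma-algebras can be taken in their intersection: integration over events
    is modular and continuous along monotone sequences of events, so that the
    limit inferior of nearly optimal events is optimal. *)
Lemma best_event (G : nat -> set (set Omega)) Y :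
  (forall k, sigma_algebra setT (G k)) ->
  (forall m n, (m <= n)%N -> G n `<=` G m) ->
  G 0%N `<=` measurable -> P.-integrable setT (EFin \o Y) ->
  exists B, (forall k, G k B) /\
    forall c, (forall k, exists2 A, G k A & c <= \int[P]_(w in A) Y w) ->
    c <= \int[P]_(w in B) Y w.
Proof.
move=> sG Gdec G0 iY.
have mG k A : G k A -> measurable A by move=> /(Gdec 0%N k isT)/G0.
have usc (A : nat -> set Omega) B : (forall n, measurable (A n)) ->
    measurable B -> (forall w, \forall n \near \oo, A n w <-> B w) ->
    usc_along (fun A => \int[P]_(w in A) Y w) A B.
  move=> mA mB AB c cA; have AY := Rintegral_event_cvg iY mA mB AB.
  rewrite -(cvg_lim _ AY)//; apply: limr_ge => //.
  by apply/cvg_ex; eexists; exact: AY.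
have GI k (A : nat -> set Omega) : (forall n, G k (A n)) -> G k (\bigcap_n A n).
  exact: (sigma_algebra_bigcap_nat (sG k)).
have [|||||||B [GB Bmax]] := @supermodular_attains _ (set Omega) R
  (fun A => \int[P]_(w in A) Y w) G; last by exists B.
- exact: Gdec.
- by move=> k; exists setT; exact: (sigma_algebra_setT (sG k)).
- exists (\int[P]_w `|Y w|) => A /mG mA.
  have iYn : P.-integrable setT (EFin \o (fun w => `|Y w|)).
    by have := integrable_abse iY.
  apply: (@le_trans _ _ (\int[P]_(w in A) `|Y w|)).
    apply: le_Rintegral => //; try exact: integrable_event.
    by move=> w _; exact: ler_norm.
  rewrite (Rintegral_setC mA)// lerDl; exact: Rintegral_ge0.
- move=> k A C GA GC; split; first exact: (sigma_algebra_setI (sG k)).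
  exact: (sigma_algebra_setU (sG k)).
- move=> A C /mG mA /mG mC; rewrite le_eqVlt; apply/orP; left; apply/eqP.
  exact: Rintegral_modular.
- move=> k A Adec GA; have Adec' m n : (m <= n)%N -> A n `<=` A m.
    by move=> mn; apply/asboolP; exact: Adec.
  exists (\bigcap_n A n); split.
  + exact: GI.
  + by move=> n; apply/asboolP => w; exact.
  + by move=> C CA; apply/asboolP => w Cw n _; have /asboolP := CA n; exact.
  + apply: usc => [n||w]; [exact: mG|exact/mG/GI|].
    have [h|/existsNP[N ANw]] := pselect (forall n, A n w).
      by apply: nearW => n; split=> // _ m _.
    exists N => // n /= Nn; split=> [Anw|/(_ N I)//].
    by case: ANw; exact: Adec' Nn _ Anw.
- move=> A Ainc GA; have Ainc' m n : (m <= n)%N -> A m `<=` A n.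
    by move=> mn; apply/asboolP; exact: Ainc.
  have GU k : G k (\bigcup_n A n).
    rewrite (_ : \bigcup_n A n = \bigcup_n A (n + k)%N).
      apply: (sigma_algebra_bigcup_nat (sG k)) => n.
      by apply: (Gdec k (n + k)%N) (leq_addl _ _) _ _.
    apply/seteqP; split=> w [n _ Anw]; last by exists (n + k)%N.
    by exists n => //; apply: Ainc' Anw; exact: leq_addr.
  exists (\bigcup_n A n); split=> //.
  apply: usc => [n||w]; [exact: mG|exact/mG/(GU 0%N)|].
  have [[N _ ANw]|nA] := pselect ((\bigcup_n A n) w).
    exists N => // n /= Nn; split=> _; last exact: Ainc' ANw.
    by exists n => //; exact: Ainc' ANw.
  by apply: nearW => n; split=> // Anw; case: nA; exists n.
Qed.

End integral_over_events.

(** * Optimal pairs of stopping times *)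

Section optimal_pairs.
Context d (Omega : measurableType d) (R : realType).
Context (P : probability Omega R) (T : R) (F : R -> set (set Omega)).
Hypotheses (T_ge0 : 0 <= T) (HF : usual_filtration P T F).
Local Notation T0 := (stopping_times T F).
Local Notation stopped := (stopped_sigma_algebra T F).
Implicit Types (a b tau theta S : Omega -> R) (A B : set Omega).
Implicit Type psi : (Omega -> R) -> (Omega -> R) -> Omega -> R.

(** The order is required everywhere, unlike in [stopping_times_from], so that
    the lattice of functions can be used; the join with [S] changes a time that
    follows [S] almost surely only on a null set. *)
Definition stopping_times_ge S : set (Omega -> R) :=
  [set tau | T0 tau /\ (S <= tau)%O].

Let stopped_event theta B : T0 theta -> stopped theta B -> measurable B.
Proof. by move=> [thT _]; exact: (stopped_measurable T_ge0 HF). Qed.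

Lemma stopping_time_attains (f : (Omega -> R) -> R)
    (u : nat -> Omega -> R) S :
  (forall n, T0 (u n)) -> {homo u : m n / (m <= n)%N >-> (m <= n)%O} ->
  (forall w, u n w @[n --> \oo] --> S w) ->
  (exists M, forall a, T0 a -> f a <= M) ->
  (forall a b, T0 a -> T0 b -> f a + f b <= f (a `&` b)%O + f (a `|` b)%O) ->
  (forall (v : nat -> Omega -> R) l, (forall n, T0 (v n)) -> T0 l ->
    monotone_to v l -> usc_along f v l) ->
  exists a, stopping_times_ge S a /\
    forall c, (forall k, exists2 b, stopping_times_ge (u k) b & c <= f b) ->
    c <= f a.
Proof.
move=> uT uinc ucv [M fM] fsup fusc.
have [|||||||a [aL amax]] := @supermodular_attains _ (Omega -> R) R f
  (fun k => stopping_times_ge (u k)).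
- by move=> m n mn a [aT una]; split=> //; apply: le_trans una; exact: uinc.
- by move=> k; exists (u k).
- by exists M => a [aT _]; exact: fM.
- move=> k a b [aT ua] [bT ub]; split; split.
  + exact: (stopping_time_meet HF).
  + by rewrite lexI ua.
  + exact: (stopping_time_join HF).
  + by apply: le_trans ua _; exact: leUl.
- by move=> a b [aT _] [bT _]; exact: fsup.
- move=> k v vdec vL; have vT n : T0 (v n) by case: (vL n).
  have [|l vl] := nonincreasing_pointwise_cvg (c := 0) vdec.
    by move=> n w; case: (vT n) => /(_ w)/andP[].
  have lT := stopping_time_nonincreasing_limit T_ge0 HF vdec vl vT.
  exists l; split.
  + split=> //; apply/lefP => w; apply: limit_ge (vl w) _ => n.
    by have [_ /lefP] := vL n; exact.
  + exact: nonincreasing_limit_le vl.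
  + move=> m ml; apply/lefP => w; apply: limit_ge (vl w) _ => n.
    by have /lefP := ml n; exact.
  + by apply: fusc => //; split=> //; left.
- move=> v vinc vL; have vT n : T0 (v n) by case: (vL n).
  have [|l vl] := nondecreasing_pointwise_cvg (c := T) vinc.
    by move=> n w; case: (vT n) => /(_ w)/andP[].
  have lT := stopping_time_nondecreasing_limit HF vinc vl vT.
  exists l; split; last by apply: fusc => //; split=> //; right.
  move=> k; split=> //; have [_ uv] := vL k; apply: le_trans uv _.
  exact: nondecreasing_limit_ge vl k.
exists a; split=> //; have [aT _] := aL 0%N; split=> //.
apply/lefP => w; apply: limit_le (ucv w) _ => n.
by have [_ /lefP] := aL n; exact.
Qed.

(** The properties of the reward on which the maximization rests. They are
    stated with real integrals over events, and are symmetric in the two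
    coordinates ([tame_flip]). *)
Record tame psi : Prop := Tame {
  tame_integrable : forall a b, T0 a -> T0 b ->
    P.-integrable setT (EFin \o psi a b) ;
  tame_bounded : exists M, forall a b, T0 a -> T0 b ->
    \int[P]_w psi a b w <= M ;
  tame_local : forall a a' b b', T0 a -> T0 a' -> T0 b -> T0 b' ->
    \forall w \ae P, a w = a' w -> b w = b' w -> psi a b w = psi a' b' w ;
  tame_continuous : forall S (u : nat -> Omega -> R), T0 S ->
    (forall n, T0 (u n)) -> monotone_to u S ->
    forall e, 0 < e -> \forall n \near \oo, forall theta B,
    T0 theta -> measurable B ->
    `|\int[P]_(w in B) psi theta (u n) w - \int[P]_(w in B) psi theta S w| <= e
    /\
    `|\int[P]_(w in B) psi (u n) theta w - \int[P]_(w in B) psi S theta w| <= e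
}.

Lemma tame_flip psi : tame psi -> tame (fun a b => psi b a).
Proof.
move=> [psi_int [M psiM] psi_loc psi_cont]; split.
- by move=> a b aT bT; exact: psi_int.
- by exists M => a b aT bT; exact: psiM.
- move=> a a' b b' aT a'T bT b'T.
  by apply: filterS (psi_loc b b' a a' bT b'T aT a'T) => w h aa bb; exact: h.
- move=> S u ST uT uS e e0; apply: filterS (psi_cont S u ST uT uS e e0) => n h.
  by move=> theta B thT mB; have [] := h theta B thT mB.
Qed.

Lemma tame_Rintegral psi a a' b b' B : tame psi ->
  T0 a -> T0 a' -> T0 b -> T0 b' -> measurable B ->
  (forall w, B w -> a w = a' w) -> (forall w, B w -> b w = b' w) ->
  \int[P]_(w in B) psi a b w = \int[P]_(w in B) psi a' b' w.
Proof.
move=> Hpsi aT a'T bT b'T mB aa bb.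
apply: ae_eq_Rintegral => //; [exact: tame_integrable..|].
by apply: filterS (tame_local Hpsi aT a'T bT b'T) => w h Bw; apply: h; auto.
Qed.

Lemma tame_patch psi theta B a a' b b' : tame psi ->
  T0 theta -> stopped theta B -> T0 a -> T0 a' -> T0 b -> T0 b' ->
  (theta <= a)%O -> (theta <= a')%O -> (theta <= b)%O -> (theta <= b')%O ->
  \int[P]_w psi (patch a' B a) (patch b' B b) w =
  \int[P]_(w in B) psi a b w + \int[P]_(w in ~` B) psi a' b' w.
Proof.
move=> Hpsi thT BF aT a'T bT b'T tha tha' thb thb'.
have mB := stopped_event thT BF.
have pT := stopping_time_patch HF thT BF aT a'T tha tha'.
have qT := stopping_time_patch HF thT BF bT b'T thb thb'.
rewrite (Rintegral_setC mB); last exact: tame_integrable.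
congr (_ + _); apply: tame_Rintegral => //; try exact: measurableC.
- by move=> w Bw; rewrite /patch mem_set.
- by move=> w Bw; rewrite /patch mem_set.
- by move=> w Bw; rewrite /patch memNset.
- by move=> w Bw; rewrite /patch memNset.
Qed.

(** Fixing one coordinate makes the expected reward a modular function of the
    other: on each of the events [a <= b] and [b < a] the meet and the join
    are [a] and [b] in some order. *)
Lemma tame_modular psi theta a b : tame psi -> T0 theta -> T0 a -> T0 b ->
  \int[P]_w psi theta a w + \int[P]_w psi theta b w =
  \int[P]_w psi theta (a `&` b)%O w + \int[P]_w psi theta (a `|` b)%O w.
Proof.
move=> Hpsi thT aT bT.
have mT := stopping_time_meet HF aT bT; have jT := stopping_time_join HF aT bT.
have mB := stopped_event aT (stopped_le_event_l HF aT bT).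
have mBC := measurableC mB.
have I c : T0 c -> P.-integrable setT (EFin \o psi theta c).
  by move=> cT; exact: tame_integrable.
rewrite !(Rintegral_setC mB); do ?exact: I.
have eqB c c' B : T0 c -> T0 c' -> measurable B ->
    (forall w, B w -> c w = c' w) ->
    \int[P]_(w in B) psi theta c w = \int[P]_(w in B) psi theta c' w.
  by move=> cT c'T mB' cc; exact: tame_Rintegral.
rewrite (eqB _ (a `&` b)%O _ aT) //; last first.
  by move=> w /= ab; rewrite meetfE meet_l.
rewrite (eqB _ (a `|` b)%O _ aT) //; last first.
  by move=> w /= /negP; rewrite -ltNge => ba; rewrite joinfE join_l// ltW.
rewrite (eqB _ (a `|` b)%O _ bT) //; last first.
  by move=> w /= ab; rewrite joinfE join_r.
rewrite (eqB _ (a `&` b)%O _ bT) //; last first.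
  by move=> w /= /negP; rewrite -ltNge => ba; rewrite meetfE meet_r// ltW.
lra.
Qed.

Lemma tame_usc psi theta : tame psi -> T0 theta ->
  forall (v : nat -> Omega -> R) l, (forall n, T0 (v n)) -> T0 l ->
  monotone_to v l -> usc_along (fun a => \int[P]_w psi theta a w) v l.
Proof.
move=> Hpsi thT v l vT lT vl c cv; apply/ler_addgt0Pr => e e0.
have [N _ h] : \forall n \near \oo, c <= \int[P]_w psi theta l w + e.
  apply: filterS2 cv (tame_continuous Hpsi lT vT vl e0) => n cn cont.
  have [/ler_normlP[_ h] _] := cont theta setT thT measurableT.
  by lra.
exact: h (leqnn N).
Qed.

(** With [u] constant this solves the problem with one stopping time. With
    [u] increasing to [S] it says moreover that the value of this problem is
    left continuous in the starting time. *)
Lemma optimal_second_time psi theta (u : nat -> Omega -> R) S :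
  tame psi -> T0 theta ->
  (forall n, T0 (u n)) -> {homo u : m n / (m <= n)%N >-> (m <= n)%O} ->
  (forall w, u n w @[n --> \oo] --> S w) ->
  exists rho, stopping_times_ge S rho /\
    forall c, (forall k, exists2 tau, stopping_times_ge (u k) tau &
      c <= \int[P]_w psi theta tau w) -> c <= \int[P]_w psi theta rho w.
Proof.
move=> Hpsi thT uT uinc uS.
apply: (stopping_time_attains uT uinc uS
  (f := fun a => \int[P]_w psi theta a w)).
- by have [M psiM] := tame_bounded Hpsi; exists M => a aT; exact: psiM.
- by move=> a b aT bT; rewrite le_eqVlt tame_modular ?eqxx.
- exact: tame_usc.
Qed.

Lemma monotone_to_join (u : nat -> Omega -> R) theta rho :
  monotone_to u theta -> (theta <= rho)%O ->
  monotone_to (fun n => (rho `|` u n)%O) rho.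
Proof.
move=> [umon ucv] /lefP thrho; split.
  case: umon => umon; [left|right] => m n mn; apply: leU2 => //; exact: umon.
move=> w; apply/cvgrPdist_lt => e e0; have := thrho w.
move/cvgrPdist_lt/(_ e e0): (ucv w) => h tr; apply: filterS h => n.
rewrite joinfE joinEtotal !ltr_norml; case: (leP (rho w) (u n w)); lra.
Qed.

(** Along a decreasing sequence starting later only restricts the choice; along
    an increasing one this is the left continuity of the value. *)
Lemma near_second_time psi theta (u : nat -> Omega -> R) :
  tame psi -> T0 theta -> (forall n, T0 (u n)) -> monotone_to u theta ->
  exists rho, stopping_times_ge theta rho /\
    forall e, 0 < e -> \forall n \near \oo, forall tau,
      stopping_times_ge (u n) tau ->
      \int[P]_w psi theta tau w <= \int[P]_w psi theta rho w + e.
Proof.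
move=> Hpsi thT uT [[udec|uinc] ucv].
- have uth := nonincreasing_limit_le udec ucv.
  have [||rho [rhoL rhomax]] :=
    @optimal_second_time psi theta (fun=> theta) theta Hpsi thT (fun=> thT).
  + by move=> m n _; exact: lexx.
  + by move=> w; exact: cvg_cst.
  exists rho; split=> // e e0; apply: nearW => n tau [tauT utau].
  rewrite -[leLHS]addr0 lerD ?(ltW e0)//; apply: rhomax => _.
  by exists tau => //; split=> //; exact: le_trans (uth n) utau.
- have [rho [rhoL rhomax]] := optimal_second_time Hpsi thT uT uinc ucv.
  exists rho; split=> // e e0.
  have [N hN] : exists N, forall tau, stopping_times_ge (u N) tau ->
      \int[P]_w psi theta tau w <= \int[P]_w psi theta rho w + e.
    apply: contrapT => /forallNP nN.
    suff : \int[P]_w psi theta rho w + e <= \int[P]_w psi theta rho w by lra.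
    apply: rhomax => k; have /existsNP[tau /not_implyP[tauL /negP]] := nN k.
    by rewrite -ltNge => /ltW; exists tau.
  exists N => // n /= Nn tau [tauT utau]; apply: hN; split=> //.
  exact: le_trans (uinc _ _ Nn) utau.
Qed.

(** A single second time [rho] serves all the first times [u n] close to
    [theta], on all the events known at these times: a better choice [tau]
    on an event [B], completed by [rho `|` u n] off [B], would be better than
    the near optimum of the whole problem. *)
Lemma near_second_time_event psi theta (u : nat -> Omega -> R) :
  tame psi -> T0 theta -> (forall n, T0 (u n)) -> monotone_to u theta ->
  exists rho, stopping_times_ge theta rho /\
    forall e, 0 < e -> \forall n \near \oo, forall B tau,
      stopped (u n) B -> stopping_times_ge (u n) tau ->
      \int[P]_(w in B) psi (u n) tau w <= \int[P]_(w in B) psi theta rho w + e.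
Proof.
move=> Hpsi thT uT uth.
have [rho [[rhoT thrho] hrho]] := near_second_time Hpsi thT uT uth.
exists rho; split=> // e e0; have e3 : 0 < e / 3 by rewrite divr_gt0.
have urho := monotone_to_join uth thrho.
have joinT n : T0 (rho `|` u n)%O by exact: (stopping_time_join HF).
have h1 := hrho _ e3.
have h2 := tame_continuous Hpsi thT uT uth e3.
have h3 := tame_continuous Hpsi rhoT joinT urho e3.
apply: filterS3 h1 h2 h3 => n h1 h2 h3 B tau uB [tauT utau].
have mB := stopped_event (uT n) uB; have mBC := measurableC mB.
have uj : (u n <= rho `|` u n)%O by exact: leUr.
have pT := stopping_time_patch HF (uT n) uB tauT (joinT n) utau uj.
have := h1 (patch (rho `|` u n)%O B tau).
have -> : \int[P]_w psi theta (patch (rho `|` u n)%O B tau) w =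
    \int[P]_(w in B) psi theta tau w +
    \int[P]_(w in ~` B) psi theta (rho `|` u n)%O w.
  rewrite (Rintegral_setC mB); last exact: tame_integrable.
  congr (_ + _); apply: tame_Rintegral => //.
    by move=> w Bw; rewrite /patch mem_set.
  by move=> w Bw; rewrite /patch memNset.
rewrite (Rintegral_setC mB (tame_integrable Hpsi thT rhoT)) => {}h1.
have /h1{}h1 : stopping_times_ge (u n) (patch (rho `|` u n)%O B tau).
  split=> //; apply/lefP => w; rewrite /patch; case: ifP => _.
    by have /lefP := utau; exact.
  by have /lefP := uj; exact.
have [_ /ler_normlP[_ h5]] := h2 tau B tauT mB.
have [/ler_normlP[h6 _] _] := h3 theta (~` B) thT mBC.
lra.
Qed.

(** When the first times [a n `&` b n] converge monotonically to [theta], an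
    optimal pair with first time [theta] does at least as well as the pairs
    [(a n, b n)] in the limit. It stops one coordinate at [theta] and
    the other one at the near optimal second time. The event that decides which
    coordinate comes first has to be known at [theta], whereas a decreasing
    sequence of first times only gives events known at each [u n]; an optimal
    event known at all of them is known at [theta] by right continuity. *)
Lemma pair_usc psi theta (u a b : nat -> Omega -> R) :
  tame psi -> T0 theta -> monotone_to u theta ->
  (forall n, T0 (a n)) -> (forall n, T0 (b n)) ->
  (forall n, u n = (a n `&` b n)%O) ->
  exists al be, [/\ T0 al, T0 be, theta = (al `&` be)%O &
    forall c, (\forall n \near \oo, c <= \int[P]_w psi (a n) (b n) w) ->
    c <= \int[P]_w psi al be w].
Proof.
move=> Hpsi thT uth aT bT uab.
have uT n : T0 (u n) by rewrite uab; exact: (stopping_time_meet HF).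
have ua n : (u n <= a n)%O by rewrite uab; exact: leIl.
have ub n : (u n <= b n)%O by rewrite uab; exact: leIr.
have [r2 [[r2T thr2] near2]] := near_second_time_event Hpsi thT uT uth.
have [r1 [[r1T thr1] near1]] :=
  near_second_time_event (tame_flip Hpsi) thT uT uth.
have [G [sG Gdec G0 Gth uG]] : exists G : nat -> set (set Omega),
    [/\ forall k, sigma_algebra setT (G k),
      forall m n, (m <= n)%N -> G n `<=` G m, G 0%N `<=` measurable,
      forall B, (forall k, G k B) -> stopped theta B &
      forall k n, (k <= n)%N -> stopped (u n) `<=` G k].
  case: uth => -[udec|uinc] ucv.
  - (* The events are known later than [theta], at times decreasing to it. *)
    exists (fun n => stopped (u n)); split.
    + by move=> k; exact: (stopped_sigma_algebraP HF).
    + move=> m n mn B; apply: (stopped_le HF) => //; exact: udec.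
    + by move=> B; exact: stopped_event (uT 0%N).
    + move=> B; apply: (stopped_nonincreasing_limit T_ge0 HF udec ucv).
      by move=> n; case: (uT n).
    + by move=> k n kn B; apply: (stopped_le HF) => //; exact: udec.
  - exists (fun=> stopped theta); split.
    + by move=> k; exact: (stopped_sigma_algebraP HF).
    + by move=> m n _ B.
    + by move=> B; exact: stopped_event thT.
    + by move=> B /(_ 0%N).
    + move=> k n kn B; apply: (stopped_le HF) => //.
      exact: (nondecreasing_limit_ge uinc ucv).
have i1 := tame_integrable Hpsi r1T thT.
have i2 := tame_integrable Hpsi thT r2T.
(* Choosing the event [A] on which the first coordinate stops at [theta] means
   maximizing the integral of the difference of the two rewards over [A]. *)
have iY : P.-integrable setT (EFin \o (psi theta r2 \- psi r1 theta)).
  by have := integrableB measurableT i2 i1.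
have intY A : measurable A ->
    \int[P]_(w in A) (psi theta r2 \- psi r1 theta) w =
    \int[P]_(w in A) psi theta r2 w + \int[P]_(w in ~` A) psi r1 theta w -
    \int[P]_w psi r1 theta w.
  move=> mA; rewrite RintegralB//; try exact: integrable_event.
  by rewrite (Rintegral_setC mA i1); lra.
have [B [GB Bmax]] := best_event sG Gdec G0 iY.
have thB := Gth _ GB; have mB := stopped_event thT thB.
exists (patch r1 B theta), (patch theta B r2); split.
- exact: (stopping_time_patch HF thT).
- exact: (stopping_time_patch HF thT).
- apply/funext => w; rewrite meetfE /patch; case: ifP => _.
    by rewrite meet_l//; move/lefP : thr2.
  by rewrite meet_r//; move/lefP : thr1.
move=> c cab; apply/ler_addgt0Pr => e e0.
have e2 : 0 < e / 2 by rewrite divr_gt0.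
rewrite (tame_patch Hpsi thT)//.
suff : c - e - \int[P]_w psi r1 theta w <=
    \int[P]_(w in B) (psi theta r2 \- psi r1 theta) w by rewrite intY//; lra.
apply: Bmax => k.
have [N _ hN] : \forall n \near \oo, c <= \int[P]_w psi (a n) (b n) w /\
    (forall A, stopped (u n) A ->
    \int[P]_(w in A) psi (u n) (b n) w <=
      \int[P]_(w in A) psi theta r2 w + e / 2 /\
    \int[P]_(w in A) psi (a n) (u n) w <=
      \int[P]_(w in A) psi r1 theta w + e / 2).
  apply: filterS3 cab (near1 _ e2) (near2 _ e2) => n h1 h2 h3; split=> // A uA.
  by split; [exact: h3|exact: h2].
pose n := maxn N k; have [cn hn] := hN n (leq_maxl N k).
pose A := [set w | a n w <= b n w].
have uA : stopped (u n) A by rewrite uab; exact: (stopped_le_event_meet HF).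
have uAC : stopped (u n) (~` A).
  exact: (sigma_algebra_setC (stopped_sigma_algebraP HF (uT n))).
have mA := stopped_event (uT n) uA; have mAC := measurableC mA.
exists A; first by apply: (uG k n) => //; exact: leq_maxr.
have [h2 _] := hn _ uA; have [_ h1] := hn _ uAC; rewrite intY//.
have : \int[P]_w psi (a n) (b n) w =
    \int[P]_(w in A) psi (u n) (b n) w + \int[P]_(w in ~` A) psi (a n) (u n) w.
  rewrite (Rintegral_setC mA); last exact: tame_integrable.
  congr (_ + _); apply: tame_Rintegral => // w.
    by move=> /= ab; rewrite uab meetfE meet_l.
  by move=> /= /negP; rewrite -ltNge => /ltW ba; rewrite uab meetfE meet_r.
lra.
Qed.

Section first_time_value.
Variable psi : (Omega -> R) -> (Omega -> R) -> Omega -> R.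
Hypothesis Hpsi : tame psi.

Definition first_time_value theta : R :=
  sup [set c | exists a b, [/\ T0 a, T0 b, theta = (a `&` b)%O &
    c = \int[P]_w psi a b w]].

Let W := first_time_value.

Lemma first_time_value_ge a b : T0 a -> T0 b ->
  \int[P]_w psi a b w <= W (a `&` b)%O.
Proof.
move=> aT bT; apply: ub_le_sup; last by exists a, b.
have [M psiM] := tame_bounded Hpsi.
by exists M => _ [a' [b' [aT' bT' _ ->]]]; exact: psiM.
Qed.

(** This is the semicontinuity along the constant sequence [theta]. *)
Lemma first_time_value_attained theta : T0 theta -> exists a b,
  [/\ T0 a, T0 b, theta = (a `&` b)%O & W theta = \int[P]_w psi a b w].
Proof.
move=> thT.
pose E := [set c | exists a b, [/\ T0 a, T0 b, theta = (a `&` b)%O &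
    c = \int[P]_w psi a b w]].
have hE : has_sup E.
  split.
    by exists (\int[P]_w psi theta theta w), theta, theta; rewrite meetxx.
  have [M psiM] := tame_bounded Hpsi.
  by exists M => _ [a' [b' [aT' bT' _ ->]]]; exact: psiM.
have /choice[ab abP] : forall n, exists ab : (Omega -> R) * (Omega -> R),
    [/\ T0 ab.1, T0 ab.2, theta = (ab.1 `&` ab.2)%O &
      W theta - n.+1%:R^-1 <= \int[P]_w psi ab.1 ab.2 w].
  move=> n; have n0 : 0 < n.+1%:R^-1 :> R by rewrite invr_gt0.
  have [c [a [b [aT bT ab ->]]] h] := sup_adherent n0 hE.
  by exists (a, b); split=> //; exact: ltW.
have [||||al [be [alT beT albe h]]] := @pair_usc psi theta (fun=> theta)
    (fun n => (ab n).1) (fun n => (ab n).2) Hpsi thT.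
- by split=> [|w]; [left => m n _; exact: lexx|exact: cvg_cst].
- by move=> n; case: (abP n).
- by move=> n; case: (abP n).
- by move=> n; case: (abP n).
exists al, be; split=> //.
apply/eqP; rewrite eq_le; apply/andP; split; last first.
  by rewrite {1}albe; exact: first_time_value_ge.
apply/ler_addgt0Pr => e e0; rewrite -lerBlDr; apply: h.
have := near_infty_natSinv_lt (PosNum e0); apply: filterS => n /= ne.
have [_ _ _] := abP n; apply: le_trans; rewrite lerB// ltW//.
Qed.

Lemma first_time_value_usc (v : nat -> Omega -> R) l :
  (forall n, T0 (v n)) -> T0 l -> monotone_to v l -> usc_along W v l.
Proof.
move=> vT lT vl c cv.
have /choice[ab abP] : forall n, exists ab : (Omega -> R) * (Omega -> R),
    [/\ T0 ab.1, T0 ab.2, v n = (ab.1 `&` ab.2)%O &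
      W (v n) = \int[P]_w psi ab.1 ab.2 w].
  move=> n; have [a [b abn]] := first_time_value_attained (vT n).
  by exists (a, b).
have [|||al [be [alT beT albe h]]] := @pair_usc psi l v
    (fun n => (ab n).1) (fun n => (ab n).2) Hpsi lT vl.
- by move=> n; case: (abP n).
- by move=> n; case: (abP n).
- by move=> n; case: (abP n).
rewrite albe; apply: le_trans (first_time_value_ge alT beT); apply: h.
by apply: filterS cv => n; have [_ _ _ ->] := abP n.
Qed.

(** Two pairs with first times [theta] and [theta'] can be recombined, along the
    event [theta <= theta'] which is known at the earlier of these times, into
    a pair that starts first and a pair that starts last. *)
Lemma first_time_value_supermodular theta theta' : T0 theta -> T0 theta' ->
  W theta + W theta' <= W (theta `&` theta')%O + W (theta `|` theta')%O.
Proof.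
move=> thT thT'.
have [a [b [aT bT ab ->]]] := first_time_value_attained thT.
have [a' [b' [aT' bT' ab' ->]]] := first_time_value_attained thT'.
pose B := [set w | theta w <= theta' w].
have mT := stopping_time_meet HF thT thT'.
have BF : stopped (theta `&` theta')%O B by exact: (stopped_le_event_meet HF).
have mB := stopped_event mT BF.
have tha : ((theta `&` theta') <= a)%O.
  by apply: le_trans (leIl _ _) _; rewrite ab; exact: leIl.
have thb : ((theta `&` theta') <= b)%O.
  by apply: le_trans (leIl _ _) _; rewrite ab; exact: leIr.
have tha' : ((theta `&` theta') <= a')%O.
  by apply: le_trans (leIr _ _) _; rewrite ab'; exact: leIl.
have thb' : ((theta `&` theta') <= b')%O.
  by apply: le_trans (leIr _ _) _; rewrite ab'; exact: leIr.
have pT c c' : T0 c -> T0 c' -> ((theta `&` theta') <= c)%O ->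
    ((theta `&` theta') <= c')%O -> T0 (patch c' B c).
  exact: (stopping_time_patch HF mT).
have -> : (theta `&` theta')%O = (patch a' B a `&` patch b' B b)%O.
  apply/funext => w; rewrite !meetfE /patch; case: ifPn => [/set_mem /= tt|].
    by rewrite meet_l// ab meetfE.
  rewrite notin_setE /= => /negP; rewrite -ltNge => /ltW tt.
  by rewrite meet_r// ab' meetfE.
have -> : (theta `|` theta')%O = (patch a B a' `&` patch b B b')%O.
  apply/funext => w; rewrite !meetfE joinfE /patch.
  case: ifPn => [/set_mem /= tt|].
    by rewrite join_r// ab' meetfE.
  rewrite notin_setE /= => /negP; rewrite -ltNge => /ltW tt.
  by rewrite join_l// ab meetfE.
apply: le_trans (lerD (first_time_value_ge _ _) (first_time_value_ge _ _));
  [|exact: pT..].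
rewrite (Rintegral_setC mB (tame_integrable Hpsi aT bT)).
rewrite (Rintegral_setC mB (tame_integrable Hpsi aT' bT')).
by rewrite !(tame_patch Hpsi mT)//; lra.
Qed.

Lemma optimal_pair S : T0 S -> exists a b,
  [/\ stopping_times_ge S a, stopping_times_ge S b &
    forall a' b', stopping_times_ge S a' -> stopping_times_ge S b' ->
    \int[P]_w psi a' b' w <= \int[P]_w psi a b w].
Proof.
move=> ST.
have [|||||theta [[thT Sth] thmax]] :=
  @stopping_time_attains W (fun=> S) S (fun=> ST).
- by move=> m n _; exact: lexx.
- by move=> w; exact: cvg_cst.
- have [M psiM] := tame_bounded Hpsi; exists M => a aT.
  by have [b [c [bT cT _ ->]]] := first_time_value_attained aT; exact: psiM.
- exact: first_time_value_supermodular.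
- exact: first_time_value_usc.
have [a [b [aT bT ab Wab]]] := first_time_value_attained thT.
exists a, b; split.
- by split=> //; apply: le_trans Sth _; rewrite ab; exact: leIl.
- by split=> //; apply: le_trans Sth _; rewrite ab; exact: leIr.
move=> a' b' [aT' Sa'] [bT' Sb']; rewrite -Wab.
apply: le_trans (first_time_value_ge aT' bT') _; apply: thmax => _.
exists (a' `&` b')%O => //; split; first exact: (stopping_time_meet HF).
by rewrite lexI Sa'.
Qed.

End first_time_value.

End optimal_pairs.

(** * Conditional expectations *)

Section conditional_expectation.
Context d (Omega : measurableType d) (R : realType) (P : probability Omega R).
Variable G : set (set Omega).
Hypotheses (sG : sigma_algebra setT G) (G_measurable : G `<=` measurable).

Implicit Types X Y : Omega -> R.

Let GT := g_sigma_algebraType G.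

Let measurable_id : measurable_fun [set: Omega] (id : Omega -> GT).
Proof.
move=> _ A mA; rewrite setTI; apply: G_measurable.
by move: mA; rewrite /measurable /= sigma_algebra_id.
Qed.

Lemma measurable_wrt_measurable X :
  measurable_wrt G X -> measurable_fun [set: Omega] X.
Proof. by move=> mX; exact: (measurableT_comp mX measurable_id). Qed.

(** Conditional expectations are Radon-Nikodym densities on the smaller
    sigma-algebra. *)
Lemma condexpP X : P.-integrable setT (EFin \o X) ->
  is_condexp P G X (condexp P G X).
Proof.
move=> iX; rewrite /condexp; apply: xgetPex => /=.
pose idm : {mfun Omega >-> GT} :=
  HB.pack (id : Omega -> GT) (isMeasurableFun.Build _ _ _ _ _ measurable_id).
pose mu := distribution P idm.
(* A pushforward is a charge for a measurable map only: the missing proof makes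
   [charge_of] a function of it. *)
pose charge_of : {charge set GT -> \bar R} :=
  pushforward (induced_charge iX) idm.
pose nu := charge_of measurable_id.
have numu : nu `<< mu.
  apply/null_content_dominatesP => A mA PA0; apply: null_set_integral => //.
  - by apply: G_measurable; move: mA; rewrite /measurable /= sigma_algebra_id.
  - exact: measurable_funTS (measurable_int _ iX).
pose f := Radon_Nikodym nu mu.
have fin x : f x \is a fin_num by exact: Radon_Nikodym_fin_num.
have fi : mu.-integrable setT f by exact: Radon_Nikodym_integrable.
have mf := measurable_int _ fi.
have eqf : EFin \o (fine \o f) = f by apply/funext => x /=; rewrite fineK.
have ifP : P.-integrable setT (f \o idm).
  apply/integrableP; split.
    exact: (measurableT_comp mf measurable_id).
  have /integrableP[_] := fi; rewrite ge0_integral_distribution//.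
  exact: measurableT_comp.
exists (fine \o f); split.
- by apply/measurable_EFinP; rewrite eqf.
- by rewrite eqf.
- move=> A GA; have mA : measurable (A : set GT).
    by rewrite /measurable /= sigma_algebra_id.
  have := Radon_Nikodym_integral numu mA.
  rewrite integral_pushforward//; last first.
    apply: integrableS ifP => //; exact: G_measurable.
  move=> nuA; transitivity (\int[P]_(x in A) f x)%E.
    by apply: eq_integral => x _; rewrite /= fineK.
  exact: esym nuA.
Qed.

(** Testing on the event where the comparison fails suffices, since this event
    belongs to [G]. *)
Lemma condexp_le X Y : P.-integrable setT (EFin \o X) ->
  P.-integrable setT (EFin \o Y) ->
  (forall A, G A -> \int[P]_(w in A) X w <= \int[P]_(w in A) Y w) ->
  \forall w \ae P, condexp P G X w <= condexp P G Y w.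
Proof.
move=> iX iY XY.
have [mX iEX EX] := condexpP iX; have [mY iEY EY] := condexpP iY.
pose Z := condexp P G X \- condexp P G Y.
pose A := [set w | 0 < Z w].
have GA : G A.
  have mZ : measurable_fun [set: GT] (Z : GT -> R) by exact: measurable_funB.
  have := mZ measurableT `]0, +oo[%classic (measurable_itv _).
  rewrite setTI /measurable /= (sigma_algebra_id sG); congr (G _).
  by apply/seteqP; split=> w; rewrite /= in_itv/= andbT.
have mA := G_measurable GA.
have iZ : P.-integrable setT (EFin \o Z).
  by have := integrableB measurableT iEX iEY.
have iZA := integrable_event mA iZ.
have Z0 : \int[P]_(w in A) Z w <= 0.
  rewrite RintegralB//; [|exact: integrable_event..].
  by rewrite subr_le0 /Rintegral EX// EY//; exact: XY.
have Z00 : \int[P]_(w in A) Z w = 0.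
  by apply/eqP; rewrite eq_le Z0; apply: Rintegral_ge0 => w /ltW.
have AZ0 : (\int[P]_(w in A) `|(EFin \o Z) w| = 0)%E.
  transitivity (\int[P]_(w in A) (Z w)%:E)%E.
    by apply: eq_integral => w /set_mem Aw; rewrite /= gtr0_norm.
  by rewrite -(fineK (integrable_fin_num mA iZA)); congr EFin.
have := (ae_eq_integral_abs P mA (measurable_int _ iZA)).1 AZ0.
apply: filterS => w ZA; rewrite leNgt; apply/negP => lt.
have Zw : 0 < Z w by rewrite /Z /= subr_gt0.
by have [Zw0] := ZA Zw; rewrite Zw0 ltxx in Zw.
Qed.

End conditional_expectation.

(** * Essential suprema *)

Section essential_supremum.
Context d (Omega : measurableType d) (R : realType) (P : probability Omega R).
Implicit Types (E : set (Omega -> \bar R)) (X V : Omega -> \bar R).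
Local Open Scope ereal_scope.

(** A finite integral excludes the default value of [family_ess_sup], so that
    the essential supremum exists. *)
Lemma family_ess_supP E : \int[P]_w family_ess_sup P E w < +oo ->
  is_family_ess_sup P E (family_ess_sup P E).
Proof.
rewrite /family_ess_sup; case: xgetP => [V _ EV //|noV].
by rewrite integral_cst//= probability_setT mule1 ltxx.
Qed.

Lemma integral_le_family_ess_sup E X : E X ->
  measurable_fun setT X -> (forall w, 0 <= X w) ->
  \int[P]_w family_ess_sup P E w < +oo ->
  \int[P]_w X w <= \int[P]_w family_ess_sup P E w.
Proof.
move=> EX mX X0 /family_ess_supP[mV XV _].
set V := family_ess_sup P E in mV XV *.
have VV : ae_eq P setT V (V^\+).
  apply: filterS (XV X EX) => w XVw _.
  by rewrite funeposE max_l// (le_trans (X0 w)).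
have mVp : measurable_fun setT (V^\+) by exact: measurable_funepos.
rewrite [leRHS](ae_eq_integral (V^\+))//; apply: ae_ge0_le_integral => //.
apply: filterS (XV X EX) => w XVw _.
by rewrite funeposE le_max XVw.
Qed.

Lemma is_family_ess_sup_unique E V V' :
  is_family_ess_sup P E V -> is_family_ess_sup P E V' ->
  \forall w \ae P, V w = V' w.
Proof.
move=> [mV EV Vmin] [mV' EV' Vmin'].
apply: filterS2 (Vmin _ mV' EV') (Vmin' _ mV EV) => w h h'.
by apply/eqP; rewrite eq_le h.
Qed.

Lemma family_ess_sup_max E X : E X -> measurable_fun setT X ->
  (forall Y, E Y -> \forall w \ae P, Y w <= X w) ->
  \forall w \ae P, family_ess_sup P E w = X w.
Proof.
move=> EX mX Xmax.
have EXs : is_family_ess_sup P E X by split=> // W mW; exact.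
apply: (is_family_ess_sup_unique _ EXs).
by apply: (@xgetPex _ _ [set V | is_family_ess_sup P E V]); exists X.
Qed.

End essential_supremum.

(** * Existence of an optimal pair *)

Section biadmissible_reward.
Context d (Omega : measurableType d) (R : realType).
Context (P : probability Omega R) (T : R) (F : R -> set (set Omega)).
Variable psi : (Omega -> R) -> (Omega -> R) -> Omega -> R.
Hypotheses (T_ge0 : 0 <= T) (HF : usual_filtration P T F).
Hypothesis psi_adm : biadmissible P T F psi.
Local Notation T0 := (stopping_times T F).

Lemma biadmissible_measurable a b : T0 a -> T0 b ->
  measurable_fun setT (psi a b).
Proof.
move=> aT bT; have [/(_ a b aT bT)[_ mpsi] _] := psi_adm.
have maxT : T0 (fun w => Num.max (a w) (b w)).
  have := stopping_time_join HF aT bT; congr (T0 _).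
  by apply/funext => w; rewrite joinfE joinEtotal.
apply: measurable_wrt_measurable mpsi.
  exact: (stopped_sigma_algebraP HF maxT).
by move=> A; apply: (stopped_measurable T_ge0 HF); case: maxT.
Qed.

Lemma measurable_dist a b a' b' : T0 a -> T0 b -> T0 a' -> T0 b' ->
  measurable_fun setT (fun w => `|psi a b w - psi a' b' w|%:E).
Proof.
move=> aT bT aT' bT'; apply/measurable_EFinP; apply: measurableT_comp => //.
by apply: measurable_funB; exact: biadmissible_measurable.
Qed.

Hypothesis psi_int : (\int[P]_w family_ess_sup P
  [set (fun w' => (psi theta S w')%:E) | theta in T0 & S in T0] w < +oo)%E.

Let mem_psi a b : T0 a -> T0 b ->
  [set (fun w' => (psi theta S w')%:E) | theta in T0 & S in T0]
  (EFin \o psi a b).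
Proof. by move=> aT bT; exists a => //; exists b. Qed.

Lemma biadmissible_integral_le a b : T0 a -> T0 b ->
  (\int[P]_w (psi a b w)%:E <= \int[P]_w family_ess_sup P
  [set (fun w' => (psi theta S w')%:E) | theta in T0 & S in T0] w)%E.
Proof.
move=> aT bT; apply: (integral_le_family_ess_sup (mem_psi aT bT)) => //.
  by apply/measurable_EFinP; exact: biadmissible_measurable.
by move=> w; rewrite lee_fin; have [/(_ a b aT bT)[]] := psi_adm.
Qed.

Lemma biadmissible_integrable a b : T0 a -> T0 b ->
  P.-integrable setT (EFin \o psi a b).
Proof.
move=> aT bT; apply/integrableP; split.
  by apply/measurable_EFinP; exact: biadmissible_measurable.
apply: le_lt_trans psi_int; apply: le_trans (biadmissible_integral_le aT bT).
rewrite le_eqVlt; apply/orP; left; apply/eqP; apply: eq_integral => w _ /=.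
by rewrite ger0_norm//; have [/(_ a b aT bT)[]] := psi_adm.
Qed.

(** [E] is one of the two families in the uniform continuity conditions. *)
Lemma Rintegral_dist_le a b a' b' (E : set (Omega -> \bar R)) (e : R) B :
  T0 a -> T0 b -> T0 a' -> T0 b' -> measurable B ->
  E (fun w => `|psi a b w - psi a' b' w|%:E) ->
  (\int[P]_w family_ess_sup P E w < e%:E)%E ->
  `|\int[P]_(w in B) psi a' b' w - \int[P]_(w in B) psi a b w| <= e.
Proof.
move=> aT bT aT' bT' mB Ed Ee.
have i := biadmissible_integrable aT bT.
have i' := biadmissible_integrable aT' bT'.
have iD : P.-integrable setT (EFin \o (psi a b \- psi a' b')).
  by have := integrableB measurableT i i'.
have iN : P.-integrable setT (EFin \o (fun w => `|psi a b w - psi a' b' w|)).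
  by have := integrable_abse iD.
rewrite distrC -RintegralB//; try exact: integrable_event.
apply: le_trans (le_normr_Rintegral mB (integrable_event mB iD)) _.
apply: (@le_trans _ _ (\int[P]_w `|psi a b w - psi a' b' w|)).
  rewrite (Rintegral_setC mB iN) lerDl; exact: Rintegral_ge0.
rewrite -lee_fin fineK; last exact: (integrable_fin_num measurableT iN).
apply: le_trans (ltW Ee); apply: integral_le_family_ess_sup => //.
- exact: measurable_dist.
- by apply: lt_trans Ee _; exact: ltry.
Qed.

Hypothesis psi_right : uniformly_right_continuous_in_expectation P T F psi.
Hypothesis psi_left : uniformly_left_continuous_in_expectation P T F psi.

Lemma biadmissible_tame : tame P T F psi.
Proof.
split.
- exact: biadmissible_integrable.
- exists (fine (\int[P]_w family_ess_sup P
    [set (fun w' => (psi theta S w')%:E) | theta in T0 & S in T0] w)%E).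
  move=> a b aT bT; have le := biadmissible_integral_le aT bT.
  apply: fine_le => //.
    exact: integrable_fin_num (biadmissible_integrable aT bT).
  rewrite fin_numElt psi_int andbT; apply: lt_le_trans le.
  rewrite (@lt_le_trans _ _ 0%E)// ?ltNy0//; apply: integral_ge0 => w _.
  by rewrite lee_fin; have [/(_ a b aT bT)[]] := psi_adm.
- by move=> a a' b b' aT aT' bT bT'; have [_] := psi_adm; exact.
- move=> S u ST uT uS e e0.
  have [c1 c2] : uniformly_close_in_expectation P T F psi u S.
    case: uS => -[umon|umon] ucv.
    + apply: psi_right => //; apply: aeW => w; split; last exact: ucv.
      by move=> m n mn; have /lefP := umon _ _ mn; exact.
    + apply: psi_left => //; apply: aeW => w; split; last exact: ucv.
      by move=> n; have /lefP := nondecreasing_limit_ge umon ucv n; exact.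
  have lt_e (x : nat -> \bar R) : x n @[n --> \oo] --> 0%E ->
      \forall n \near \oo, (x n < e%:E)%E.
    by move=> x0; have := x0 _ (@open_ereal_lt' _ 0%E e%:E e0).
  apply: filterS2 (lt_e _ c1) (lt_e _ c2) => n h1 h2 theta B thT mB.
  split; [apply: Rintegral_dist_le h1|apply: Rintegral_dist_le h2] => //.
  + by exists theta.
  + by exists theta.
Qed.

End biadmissible_reward.

Theorem mainTheorem3 (d : measure_display) (Omega : measurableType d)
    (R : realType) (P : probability Omega R) (T : R)
    (F : R -> set (set Omega))
    (psi : (Omega -> R) -> (Omega -> R) -> Omega -> R) :
  0 <= T ->
  usual_filtration P T F ->
  biadmissible P T F psi ->
  (\int[P]_w family_ess_sup P
     [set (fun w' => (psi theta S w')%:E)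
       | theta in stopping_times T F & S in stopping_times T F] w
   < +oo)%E ->
  uniformly_right_continuous_in_expectation P T F psi ->
  uniformly_left_continuous_in_expectation P T F psi ->
  (exists p : R, 1 < p /\
    (\int[P]_w family_ess_sup P
       [set (fun w' => (psi theta S w' `^ p)%:E)
         | theta in stopping_times T F & S in stopping_times T F] w
     < +oo)%E) ->
  forall S : Omega -> R, stopping_times T F S ->
  exists tau1 tau2 : Omega -> R,
    [/\ stopping_times_from P T F S tau1,
        stopping_times_from P T F S tau2 &
        \forall w \ae P,
          value P T F psi S w =
          (condexp P (stopped_sigma_algebra T F S) (psi tau1 tau2) w)%:E].
Proof.
move=> T_ge0 HF psi_adm psi_int psi_right psi_left _ S ST.
have Hpsi := biadmissible_tame T_ge0 HF psi_adm psi_int psi_right psi_left.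
have [t1 [t2 [[t1T St1] [t2T St2] tmax]]] := optimal_pair T_ge0 HF Hpsi ST.
have from1 : stopping_times_from P T F S t1.
  by split=> //; apply: aeW => w; move/lefP : St1.
have from2 : stopping_times_from P T F S t2.
  by split=> //; apply: aeW => w; move/lefP : St2.
exists t1, t2; split=> //.
have sG := stopped_sigma_algebraP HF ST.
have Gm : stopped_sigma_algebra T F S `<=` measurable.
  by move=> A; apply: (stopped_measurable T_ge0 HF); case: ST.
have it := tame_integrable Hpsi t1T t2T.
apply: family_ess_sup_max; first by exists t1 => //; exists t2.
  apply/measurable_EFinP; apply: (measurable_wrt_measurable sG Gm).
  by have [] := condexpP sG Gm it.
move=> _ [a [aT Sa] [b [bT Sb] <-]].
suff : \forall w \ae P, condexp P (stopped_sigma_algebra T F S) (psi a b) w <=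
    condexp P (stopped_sigma_algebra T F S) (psi t1 t2) w.
  by apply: filterS => w; rewrite lee_fin.
apply: condexp_le => //; first exact: tame_integrable Hpsi _ _ aT bT.
move=> A GA; have mA := Gm _ GA.
(* Move [a] and [b] after [S] everywhere, and not only almost surely. *)
have aT' := stopping_time_join HF aT ST.
have bT' := stopping_time_join HF bT ST.
have Sa' : (S <= a `|` S)%O by exact: leUr.
have Sb' : (S <= b `|` S)%O by exact: leUr.
have -> : \int[P]_(w in A) psi a b w =
    \int[P]_(w in A) psi (a `|` S)%O (b `|` S)%O w.
  apply: ae_eq_Rintegral => //; [exact: (tame_integrable Hpsi)..|].
  apply: filterS3 Sa Sb (tame_local Hpsi aT aT' bT bT') => w Saw Sbw h _.
  by apply: h; rewrite joinfE join_l.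
have := tmax (patch t1 A (a `|` S)%O) (patch t2 A (b `|` S)%O).
rewrite (tame_patch T_ge0 HF Hpsi ST)// (Rintegral_setC mA it) lerD2r; apply.
- split; first exact: (stopping_time_patch HF ST).
  apply/lefP => w; rewrite /patch; case: ifP => _; last by move/lefP : St1.
  by move/lefP : Sa'.
- split; first exact: (stopping_time_patch HF ST).
  apply/lefP => w; rewrite /patch; case: ifP => _; last by move/lefP : St2.
  by move/lefP : Sb'.
Qed.
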